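(* Let $A,B\in M_{d}^{+}$, $0\leq v\leq1$, and let $N$ be a nonnegative integer. Then $$(A\nabla_{v}B)^{-1}\ \leq\ A^{-1}\nabla_{v}B^{-1}-\sum_{n=0}^{N-1}r_{n}(v)\sum_{k=1}^{2^{n}}F_{n,k}(A,B)\,\chi_{\left(\frac{k-1}{2^{n}},\frac{k}{2^{n}}\right)}(v),$$ where $$F_{n,k}(A,B)=\left(A\nabla_{\frac{k-1}{2^{n}}}B\right)^{-1}+\left(A\nabla_{\frac{k}{2^{n}}}B\right)^{-1}-2\left(A\nabla_{\frac{2k-1}{2^{n+1}}}B\right)^{-1}.$$
   Context: $M_d^+$ is the set of $d\times d$ complex positive definite matrices. For Hermitian matrices, $A\le B$ means $B-A$ is positive semidefinite. $A\nabla_vB=(1-v)A+vB$. The functions $r_n:[0,1]\to\mathbb{R}$ are defined recursively by $r_0(v)=\min\{v,1-v\}$ and $r_n(v)=\min\{2r_{n-1}(v),1-2r_{n-1}(v)\}$ for $n\ge 1$. $\chi_I$ is the characteristic function of the interval $I$. A sum $\sum_{n=0}^{N-1}$ is zero when $N=0$. *)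

(* Defs.v *)
From HB Require Import structures.
From mathcomp Require Import all_boot all_order all_algebra.
From mathcomp Require Import complex.
From mathcomp Require Import classical_sets set_interval reals numfun.

Set Implicit Arguments.
Unset Strict Implicit.
Unset Printing Implicit Defensive.

Import Order.TTheory GRing.Theory Num.Theory.

Local Open Scope ring_scope.
Local Open Scope complex_scope.
Local Open Scope sesquilinear_scope.

(* On [R[i]], [0 <= z] (resp. [0 < z]) means that [z] is real and nonnegative
   (resp. positive). *)
Definition psdmx (R : realType) (d : nat) (A : 'M[R[i]]_d) : Prop :=
  A \is hermsymmx /\ forall x : 'cV[R[i]]_d, 0 <= (x ^t* *m A *m x) 0 0.

Definition pdmx (R : realType) (d : nat) (A : 'M[R[i]]_d) : Prop :=
  A \is hermsymmx /\
  forall x : 'cV[R[i]]_d, x != 0 -> 0 < (x ^t* *m A *m x) 0 0.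

Definition loewner_le (R : realType) (d : nat) (A B : 'M[R[i]]_d) : Prop :=
  psdmx (B - A).

Definition nabla (R : realType) (d : nat) (v : R) (A B : 'M[R[i]]_d) :
    'M[R[i]]_d :=
  (1 - v)%:C *: A + v%:C *: B.

(* Defined on all of [R], but only meaningful for [v] in [0, 1]. *)
Fixpoint rn (R : realType) (n : nat) (v : R) : R :=
  match n with
  | 0%N => Num.min v (1 - v)
  | m.+1 => Num.min (2 * rn m v) (1 - 2 * rn m v)
  end.

Definition Fnk (R : realType) (d n k : nat) (A B : 'M[R[i]]_d) : 'M[R[i]]_d :=
  invmx (nabla ((k%:R - 1) / 2 ^+ n) A B)
  + invmx (nabla (k%:R / 2 ^+ n) A B)
  - 2 *: invmx (nabla ((2 * k%:R - 1) / 2 ^+ n.+1) A B).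

(* Main.v *)
Require Import Defs.
From HB Require Import structures.
From mathcomp Require Import all_boot all_order all_algebra.
From mathcomp Require Import complex.
From mathcomp Require Import classical_sets set_interval reals numfun.
From mathcomp Require Import ring lra.

Set Implicit Arguments.
Unset Strict Implicit.
Unset Printing Implicit Defensive.

Import Order.TTheory GRing.Theory Num.Theory.

Local Open Scope ring_scope.
Local Open Scope complex_scope.

(** Put [f u = (nabla u A B)^-1].  Three facts combine.

    First, subtracting the terms of levels [n < N] from the chord of [f] over
    [0, 1] yields exactly the piecewise linear interpolant of [f] at the nodes
    [k / 2 ^ N].  Indeed [rn n v] is the distance from [2 ^ n * v] to the
    nearest integer, so on a dyadic interval of level [n] the correction
    [rn n v *: F] is a tent whose height is the gap between the midpoint of the
    chord and the value of [f] at the middle of the interval: subtracting it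
    replaces one chord by the two chords of its halves.  This holds for any
    function into a module ([dyadic_interpolation]).

    Second, [f] is operator convex: if [Z = nabla t X Y] then
      [nabla t X^-1 Y^-1 - Z^-1
         = nabla t ((X^-1 - Z^-1) X (X^-1 - Z^-1))
                   ((Y^-1 - Z^-1) Y (Y^-1 - Z^-1))],
    a convex combination of congruences of positive matrices
    ([invmx_nabla_le]).

    Third, [nabla] is affine in its parameter, so that on a dyadic interval
    [nabla v A B] is itself a weighted mean of the values at the two end points
    ([nabla_nabla]); convexity then says that [f v] lies below the chord. *)

(** * Positive matrices *)

Section PositiveMatrices.

Local Open Scope sesquilinear_scope.

Variables (R : realType) (d : nat).
Implicit Types (A B X Y P Q : 'M[R[i]]_d) (t u v : R).

Lemma conj_real t : Num.conj (t%:C) = t%:C :> R[i].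
Proof. by rewrite conj_Creal// complex_real. Qed.

Lemma hermsymmxP A : A \is hermsymmx <-> A ^t* = A.
Proof.
rewrite is_hermitianmxE expr0 scale1r; split; first by move=> /eqP <-.
by move=> ->.
Qed.

Lemma adjmxM m n p (A : 'M[R[i]]_(m, n)) (B : 'M[R[i]]_(n, p)) :
  (A *m B) ^t* = B ^t* *m A ^t*.
Proof. by rewrite trmx_mul map_mxM. Qed.

Lemma nablaD t A B X Y :
  nabla t (A + X) (B + Y) = nabla t A B + nabla t X Y.
Proof. by rewrite /nabla !scalerDr addrACA. Qed.

Lemma nablaN t A B : nabla t (- A) (- B) = - nabla t A B.
Proof. by rewrite /nabla !scalerN opprD. Qed.

Lemma nablaxx t A : nabla t A A = A.
Proof. by rewrite /nabla -scalerDl -rmorphD subrK scale1r. Qed.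

Lemma nabla_hermsymmx t A B :
  A \is hermsymmx -> B \is hermsymmx -> nabla t A B \is hermsymmx.
Proof.
move=> /hermsymmxP hA /hermsymmxP hB; apply/hermsymmxP.
by rewrite /nabla linearD !linearZ /= map_mxD !map_mxZ /= !conj_real hA hB.
Qed.

Lemma invmx_hermsymmx A : A \is hermsymmx -> invmx A \is hermsymmx.
Proof.
by move=> /hermsymmxP hA; apply/hermsymmxP; rewrite trmx_inv map_invmx hA.
Qed.

Lemma mulmx_nabla m n (P : 'M[R[i]]_(m, d)) (Q : 'M[R[i]]_(d, n)) t A B :
  P *m nabla t A B *m Q =
  (1 - t)%:C *: (P *m A *m Q) + t%:C *: (P *m B *m Q).
Proof. by rewrite /nabla mulmxDr mulmxDl -!scalemxAr -!scalemxAl. Qed.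

Lemma form_nabla t A B (x : 'cV[R[i]]_d) :
  (x ^t* *m nabla t A B *m x) 0 0 =
  (1 - t)%:C * (x ^t* *m A *m x) 0 0 + t%:C * (x ^t* *m B *m x) 0 0.
Proof. by rewrite mulmx_nabla mxE [X in X + _]mxE [X in _ + X]mxE. Qed.

Lemma pdmx_psdmx A : pdmx A -> psdmx A.
Proof.
move=> [hA pA]; split=> // x; have [->|x0] := eqVneq x 0; last exact/ltW/pA.
by rewrite mulmx0 mxE.
Qed.

Lemma psdmx_nabla t A B :
  0 <= t -> t <= 1 -> psdmx A -> psdmx B -> psdmx (nabla t A B).
Proof.
move=> t0 t1 [hA pA] [hB pB]; split; first exact: nabla_hermsymmx.
move=> x; rewrite form_nabla addr_ge0// mulr_ge0// lecR; lra.
Qed.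

Lemma pdmx_nabla t A B :
  0 <= t -> t <= 1 -> pdmx A -> pdmx B -> pdmx (nabla t A B).
Proof.
move=> t0 t1 [hA pA] [hB pB]; split; first exact: nabla_hermsymmx.
move=> x x0; rewrite form_nabla.
have [->|tN0] := eqVneq t 0.
  by rewrite subr0 mul1r mul0r addr0 pA.
have tp : 0 < t by rewrite lt_neqAle eq_sym tN0.
apply: ltr_wpDl; first by rewrite mulr_ge0 ?lecR ?subr_ge0//; exact/ltW/pA.
by rewrite mulr_gt0 ?ltcR//; exact: pB.
Qed.

Lemma psdmx_congr A P : psdmx A -> psdmx (P ^t* *m A *m P).
Proof.
move=> [/hermsymmxP hA pA]; split.
  apply/hermsymmxP; rewrite !adjmxM hA mulmxA; congr (_ *m _ *m _).
  exact: trmxCK.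
by move=> x; have := pA (P *m x); rewrite adjmxM !mulmxA.
Qed.

Lemma pdmx_unitmx A : pdmx A -> A \in unitmx.
Proof.
move=> [_ pA]; rewrite -unitmx_tr -row_free_unit -kermx_eq0.
apply/rowV0P => y /sub_kermxP yA; apply/eqP; apply: contraT => y0.
have Ay : A *m y^T = 0 by rewrite -[A]trmxK -trmx_mul yA trmx0.
by have := pA y^T; rewrite trmx_eq0 -mulmxA Ay mulmx0 mxE ltxx => /(_ y0).
Qed.

(** Let [Z = nabla t A B] and [P = invmx X - invmx Z] for [X] either of [A],
    [B].  The congruence [P ^t* *m X *m P] expands to
    [invmx X - 2 *: invmx Z + invmx Z *m X *m invmx Z], and averaging over
    [A] and [B] turns the last term into
    [invmx Z *m Z *m invmx Z = invmx Z]. *)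
Lemma invmx_nabla_le t A B : 0 <= t -> t <= 1 -> pdmx A -> pdmx B ->
  loewner_le (invmx (nabla t A B)) (nabla t (invmx A) (invmx B)).
Proof.
move=> t0 t1 pA pB; have pZ := pdmx_nabla t0 t1 pA pB.
pose W := invmx (nabla t A B).
have adjBW X : pdmx X -> (invmx X - W) ^t* = invmx X - W.
  move=> [hX _]; have [hZ _] := pZ.
  move: (invmx_hermsymmx hX) (invmx_hermsymmx hZ).
  move=> /hermsymmxP hXV /hermsymmxP hW.
  by rewrite linearB /= map_mxB /= hXV hW.
have congrE X : pdmx X -> (invmx X - W) ^t* *m X *m (invmx X - W) =
    invmx X - W - W + W *m X *m W.
  move=> pX; have uX := pdmx_unitmx pX; rewrite adjBW// mulmxBl mulVmx//.
  rewrite !mulmxBl mul1mx !mulmxBr mulmxK// opprB addrA.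
  by rewrite [RHS]addrAC.
have WZW : nabla t (W *m A *m W) (W *m B *m W) = W.
  by rewrite -[LHS]mulmx_nabla mulVmx ?mul1mx//; exact: pdmx_unitmx.
rewrite /loewner_le -/W.
suff -> : nabla t (invmx A) (invmx B) - W =
  nabla t ((invmx A - W) ^t* *m A *m (invmx A - W))
          ((invmx B - W) ^t* *m B *m (invmx B - W)).
  by apply: psdmx_nabla => //; apply/psdmx_congr/pdmx_psdmx.
by rewrite !congrE// !(nablaD, nablaN, nablaxx) WZW subrK.
Qed.

(** Reduces a chord of [fun s => invmx (nabla s A B)] over any subinterval
    [u, v] to [invmx_nabla_le], applied to the values of [nabla] at its ends. *)
Lemma nabla_nabla t u v A B :
  nabla t (nabla u A B) (nabla v A B) = nabla ((1 - t) * u + t * v) A B.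
Proof.
rewrite /nabla !scalerDr !scalerA addrACA -!scalerDl -!rmorphM -!rmorphD.
by congr (_%:C *: _ + _%:C *: _); ring.
Qed.

Lemma nabla0 A B : nabla 0 A B = A.
Proof. by rewrite /nabla subr0 scale1r scale0r addr0. Qed.

Lemma nabla1 A B : nabla 1 A B = B.
Proof. by rewrite /nabla subrr scale1r scale0r add0r. Qed.

End PositiveMatrices.

(** * Dyadic interpolation *)

Section DyadicInterpolation.

Variables (R : realType) (V : lmodType R[i]).

(** The open dyadic intervals of a given level are disjoint, so [v] selects a
    single term of the sum. *)
Lemma sum_dyadic_indicator n j (t v : R) (G : nat -> V) :
    (j < 2 ^ n)%N -> 0 < t -> t < 1 -> v = (j%:R + t) / 2 ^+ n ->
  \sum_(1 <= k < (2 ^ n).+1)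
     (\1_[set` `](k%:R - 1) / 2 ^+ n, k%:R / 2 ^+ n[ ] v)%:C *: G k = G j.+1.
Proof.
move=> jn t0 t1 ->.
have p0 : 0 < 2 ^+ n :> R by exact: exprn_gt0.
have inE k : (\1_[set` `](k%:R - 1) / 2 ^+ n, k%:R / 2 ^+ n[ ]
    ((j%:R + t) / 2 ^+ n) = (k == j.+1)%:R :> R).
  rewrite indicE; congr (_ %:R); congr (nat_of_bool _).
  rewrite mem_setE in_itv /= !ltr_pM2r ?invr_gt0//.
  apply/andP/eqP => [[kj jk]|->]; last by rewrite -natr1; split; lra.
  apply/eqP; rewrite eqn_leq; apply/andP; split.
    have : k%:R < j.+2%:R :> R by rewrite -!natr1; lra.
    by rewrite ltr_nat.
  have : j%:R < k%:R :> R by lra.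
  by rewrite ltr_nat.
rewrite (bigD1_seq j.+1) ?iota_uniq//=; last first.
  by rewrite mem_index_iota /= ltnS.
rewrite inE eqxx scale1r big1 ?addr0// => k /negbTE kj.
by rewrite inE kj scale0r.
Qed.

(** Subtracting from the chord through [a] and [b] a tent whose height is the
    gap between the midpoint of the chord and [m] gives the broken line through
    [a], [m] and [b]; on each half, the position [t] is rescaled to [0, 1]. *)
Lemma chord_sub_tent_left (t : R) (a b m : V) :
  (1 - t)%:C *: a + t%:C *: b - t%:C *: (a + b - 2 *: m) =
  (1 - 2 * t)%:C *: a + (2 * t)%:C *: m.
Proof.
rewrite !scalerDr scalerN scalerA !opprD opprK addrA addrACA.
rewrite subrr addr0 -scalerBl -rmorphB; congr (_%:C *: _ + _ *: _); first ring.
by rewrite mulrC rmorphM rmorph_nat.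
Qed.

Lemma chord_sub_tent_right (t : R) (a b m : V) :
  (1 - t)%:C *: a + t%:C *: b - (1 - t)%:C *: (a + b - 2 *: m) =
  (1 - (2 * t - 1))%:C *: m + (2 * t - 1)%:C *: b.
Proof.
rewrite (addrC a) (addrC (_ *: a)).
have := chord_sub_tent_left (1 - t) b a m.
rewrite subKr addrC => ->.
rewrite [RHS]addrC; congr (_%:C *: _ + _%:C *: _); ring.
Qed.

(** Each level halves the current dyadic interval and subtracts its tent, which
    keeps the half containing [v]; [t] is the relative position of [v] in the
    interval, doubled (and shifted by one on the right) at each step, and this
    is the recursion that defines [rn].  At a node both adjacent intervals
    qualify and give the same value, so any choice of [j] supports the
    induction. *)
Lemma dyadic_interpolation (f : R -> V) (v : R) (N : nat) :
    0 <= v -> v <= 1 ->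
  exists j (t : R),
    [/\ (j < 2 ^ N)%N, 0 <= t <= 1, v = (j%:R + t) / 2 ^+ N,
        rn N v = Num.min t (1 - t)
      & (1 - v)%:C *: f 0 + v%:C *: f 1 - \sum_(0 <= n < N) (rn n v)%:C *:
          \sum_(1 <= k < (2 ^ n).+1)
             (\1_[set` `](k%:R - 1) / 2 ^+ n, k%:R / 2 ^+ n[ ] v)%:C *:
             (f ((k%:R - 1) / 2 ^+ n) + f (k%:R / 2 ^+ n)
              - 2 *: f ((2 * k%:R - 1) / 2 ^+ n.+1))
        = (1 - t)%:C *: f (j%:R / 2 ^+ N) + t%:C *: f (j.+1%:R / 2 ^+ N)].
Proof.
move=> v0 v1; elim: N => [|N [j [t [jN /andP[t0 t1] vE rE SE]]]].
  exists 0%N, v; rewrite !expr0 !divr1 add0r v0 v1 big_geq// subr0.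
  by split.
rewrite big_nat_recr//= opprD addrA SE.
set c := f (j%:R / _); set e := f (_ / _).
pose m := f ((2 * j.+1%:R - 1) / 2 ^+ N.+1).
have -> : (rn N v)%:C *: \sum_(1 <= k < (2 ^ N).+1)
       (\1_[set` `](k%:R - 1) / 2 ^+ N, k%:R / 2 ^+ N[ ] v)%:C *:
       (f ((k%:R - 1) / 2 ^+ N) + f (k%:R / 2 ^+ N)
        - 2 *: f ((2 * k%:R - 1) / 2 ^+ N.+1)) =
    (Num.min t (1 - t))%:C *: (c + e - 2 *: m).
  (* At an end point the indicators of this level all vanish, but so does the
     height of the tent, hence both sides are zero. *)
  rewrite rE; have [->|tn0] := eqVneq t 0.
    by rewrite subr0 (min_l ler01) !scale0r.
  have [->|tn1] := eqVneq t 1.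
    by rewrite subrr (min_r ler01) !scale0r.
  rewrite (@sum_dyadic_indicator N j t)//; last 2 first.
  - by rewrite lt_neqAle eq_sym tn0.
  - by rewrite lt_neqAle tn1.
  by rewrite -{1}natr1 addrK.
have p0 : 2 ^+ N != 0 :> R by rewrite expf_neq0// pnatr_eq0.
have [th|th] := leP t (2^-1).
  have tm : Num.min t (1 - t) = t by apply/min_idPl; lra.
  exists j.*2, (2 * t); split.
  - by rewrite expnS mul2n ltn_double.
  - by apply/andP; split; lra.
  - by rewrite vE exprS -mul2n natrM; field.
  - by rewrite rE tm.
  rewrite tm chord_sub_tent_left /c /m; congr (_ *: f _ + _ *: f _).
  - by rewrite exprS -mul2n natrM; field.
  - by rewrite -(@natr1 _ j) -(@natr1 _ j.*2) -mul2n natrM; congr (_ / _); ring.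
have tm : Num.min t (1 - t) = 1 - t by apply/min_idPr; lra.
exists j.*2.+1, (2 * t - 1); split.
- by rewrite expnS mul2n ltn_Sdouble.
- by apply/andP; split; lra.
- by rewrite vE exprS -(@natr1 _ j.*2) -mul2n natrM; field.
- by rewrite rE tm minC; congr (Num.min _ _); ring.
rewrite tm chord_sub_tent_right /e /m; congr (_ *: f _ + _ *: f _).
- by rewrite -(@natr1 _ j) -(@natr1 _ j.*2) -mul2n natrM; congr (_ / _); ring.
- rewrite exprS -(@natr1 _ j.*2.+1) -(@natr1 _ j.*2) -(@natr1 _ j) -mul2n natrM.
  by field.
Qed.

End DyadicInterpolation.

Theorem theorem18 (R : realType) (d : nat) (A B : 'M[R[i]]_d) (v : R) (N : nat)
    (hA : pdmx A) (hB : pdmx B) (hv0 : 0 <= v) (hv1 : v <= 1) :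
  loewner_le
    (invmx (nabla v A B))
    (nabla v (invmx A) (invmx B)
     - \sum_(0 <= n < N) (rn n v)%:C *:
         \sum_(1 <= k < (2 ^ n).+1)
           (\1_[set` `](k%:R - 1) / 2 ^+ n, k%:R / 2 ^+ n[ ] v)%:C
             *: Fnk n k A B).
Proof.
have [j [t [jN /andP[t0 t1] vE _ SE]]] :=
  dyadic_interpolation (fun u => invmx (nabla u A B)) N hv0 hv1.
rewrite /= nabla0 nabla1 in SE; rewrite [X in loewner_le _ X]SE.
have p0 : 0 < 2 ^+ N :> R by exact: exprn_gt0.
have pn (k : nat) : (k <= 2 ^ N)%N -> pdmx (nabla (k%:R / 2 ^+ N) A B).
  move=> kN; apply: pdmx_nabla => //; first by rewrite divr_ge0// ltW.
  by rewrite ler_pdivrMr// mul1r -natrX ler_nat.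
have -> : nabla v A B =
    nabla t (nabla (j%:R / 2 ^+ N) A B) (nabla (j.+1%:R / 2 ^+ N) A B).
  rewrite nabla_nabla vE -natr1; congr nabla; field.
  by rewrite gt_eqF.
exact: invmx_nabla_le t0 t1 (pn _ (ltnW jN)) (pn _ jN).
Qed.
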